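(* Let $\Gamma=(X,R)$ be a bipartite distance-regular graph with diameter $D\ge4$ and valency $k\ge3$, fix $x\in X$, let $W$ be a thin irreducible $T(x)$-module with endpoint $2$ and local eigenvalue $\eta$ with $\tilde\theta_1<\eta<\tilde\theta_d$, and let $v$ be a nonzero vector in $E^*_2W$. Then $E_1v,\dots,E_{D-1}v$ are mutually orthogonal, and: (i) if $\eta\ne-1$, then with $\psi=b_2\bigl(1-\frac{b_3}{1+\eta}\bigr)$, $$\|E_iv\|^2=\frac{m_i(\theta_i-k)(\theta_i+k)(\theta_i^2-\psi)}{|X|\,k\,b_1(\psi-b_2)}\|v\|^2\qquad(1\le i\le D-1);$$ (ii) if $\eta=-1$, then $$\|E_iv\|^2=\frac{m_i(k-\theta_i)(k+\theta_i)}{|X|\,k\,b_1}\|v\|^2\qquad(1\le i\le D-1).$$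
   Context: $\Gamma$ is a finite connected bipartite distance-regular graph with distance $\partial$, intersection numbers $c_i,b_i$. $A_i$ distance matrices, $A=A_1$, eigenvalues $\theta_0=k>\theta_1>\dots>\theta_D$, $E_i$ primitive idempotent for $\theta_i$, $m_i=\operatorname{rank}E_i$; $d=\lfloor D/2\rfloor$. $V=\mathbb{C}^X$ with $\langle u,w\rangle=u^t\bar w$, $\|u\|^2=\langle u,u\rangle$. $E^*_i$ diagonal with $(y,y)$-entry $1$ if $\partial(x,y)=i$, else $0$; $T(x)$ generated by $A,E^*_0,\dots,E^*_D$; thin: $\dim E^*_iW\le1$ for all $i$; endpoint $\min\{i:E^*_iW\ne0\}$; local eigenvalue of a thin irreducible $W$ with endpoint 2: eigenvalue of $E^*_2A_2E^*_2$ on $E^*_2W$. $\tilde\theta_1=-1-b_2b_3(\theta_1^2-b_2)^{-1}$, $\tilde\theta_d=-1-b_2b_3(\theta_d^2-b_2)^{-1}$. *)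

(* Defs.v *)
From HB Require Import structures.
From mathcomp Require Import all_boot all_order all_algebra.
From mathcomp Require Import complex.
From mathcomp Require Import reals.

Set Implicit Arguments.
Unset Strict Implicit.
Unset Printing Implicit Defensive.

Import Order.TTheory GRing.Theory Num.Theory.
Local Open Scope ring_scope.

(* Graphs are adjacency relations [e : rel X] on a finite vertex type.        *)

Definition connected (X : finType) (e : rel X) : Prop :=
  forall y z : X, connect e y z.

Definition bipartite (X : finType) (e : rel X) : Prop :=
  exists S : {set X}, forall y z : X, e y z -> (y \in S) != (z \in S).

(* Least length of a walk from y to z. Such a length is always < #|X| when    *)
(* there is a walk; for disconnected y, z the value is #|X| (never used here).*)
Definition dist (X : finType) (e : rel X) (y z : X) : nat :=
  find (fun n => [exists s : n.-tuple X, path e y s && (last y s == z)])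
       (iota 0 #|X|).

Definition diameter (X : finType) (e : rel X) : nat :=
  (\max_(y : X) \max_(z : X) dist e y z)%N.

(* [p h i j] is the intersection number p^h_{ij}. It is determined by e for   *)
(* h <= diameter e, and unconstrained (and irrelevant) for larger h.          *)
Definition distance_regular (X : finType) (e : rel X)
    (p : nat -> nat -> nat -> nat) : Prop :=
  [/\ symmetric e, irreflexive e, connected e &
      forall (h i j : nat) (y z : X), dist e y z = h ->
        #|[set w | (dist e y w == i) && (dist e z w == j)]| = p h i j].

Definition valency (p : nat -> nat -> nat -> nat) : nat := p 0%N 1%N 1%N.

Definition bnum (p : nat -> nat -> nat -> nat) (i : nat) : nat := p i 1%N i.+1.

(* Matrices and vectors indexed by X use the enumeration of X.                *)

Definition distance_mx (C : numClosedFieldType) (X : finType) (e : rel X)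
    (i : nat) : 'M[C]_#|X| :=
  \matrix_(a, b) (dist e (enum_val a) (enum_val b) == i)%:R.

Definition adj_mx (C : numClosedFieldType) (X : finType) (e : rel X) :
    'M[C]_#|X| :=
  \matrix_(a, b) (e (enum_val a) (enum_val b))%:R.

Definition dual_idem (C : numClosedFieldType) (X : finType) (e : rel X)
    (x : X) (i : nat) : 'M[C]_#|X| :=
  diag_mx (\row_a (dist e x (enum_val a) == i)%:R).

(* Unital subalgebra of the full matrix algebra generated by G.               *)
Inductive gen_alg (C : numClosedFieldType) (n : nat) (G : 'M[C]_n -> Prop) :
    'M[C]_n -> Prop :=
| gen_alg_gen M of G M : gen_alg G M
| gen_alg_scalar a : gen_alg G a%:M
| gen_alg_add M N of gen_alg G M & gen_alg G N : gen_alg G (M + N)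
| gen_alg_mul M N of gen_alg G M & gen_alg G N : gen_alg G (M *m N).

Definition bose_mesner (C : numClosedFieldType) (X : finType) (e : rel X) :
    'M[C]_#|X| -> Prop :=
  gen_alg (fun M => M = adj_mx C e).

Definition terwilliger (C : numClosedFieldType) (X : finType) (e : rel X)
    (x : X) : 'M[C]_#|X| -> Prop :=
  gen_alg (fun M => M = adj_mx C e \/
    exists2 i : nat, (i <= diameter e)%N & M = dual_idem C e x i).

(* theta_0 = k > theta_1 > ... > theta_D is the list of all eigenvalues of A. *)
(* In C the order [a < b] forces b - a to be real, so all theta_i are real.   *)
Definition ordered_eigenvalues (C : numClosedFieldType) (X : finType)
    (e : rel X) (p : nat -> nat -> nat -> nat) (theta : nat -> C) : Prop :=
  [/\ theta 0%N = (valency p)%:R,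
      forall i j : nat, (i < j <= diameter e)%N -> theta j < theta i &
      forall a : C, eigenvalue (adj_mx C e) a <->
        exists2 i : nat, (i <= diameter e)%N & a = theta i].

Definition idempotent_in (C : numClosedFieldType) (n : nat)
    (B : 'M[C]_n -> Prop) (F : 'M[C]_n) : Prop :=
  B F /\ F *m F = F.

Definition primitive_idempotent_in (C : numClosedFieldType) (n : nat)
    (B : 'M[C]_n -> Prop) (E : 'M[C]_n) : Prop :=
  [/\ idempotent_in B E, E != 0 &
      forall F G : 'M[C]_n, idempotent_in B F -> idempotent_in B G ->
        F *m G = 0 -> G *m F = 0 -> E = F + G -> F = 0 \/ G = 0].

Definition primitive_idempotent_for (C : numClosedFieldType) (X : finType)
    (e : rel X) (theta : C) (E : 'M[C]_#|X|) : Prop :=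
  primitive_idempotent_in (@bose_mesner C X e) E /\
  adj_mx C e *m E = theta *: E.

Definition inner (C : numClosedFieldType) (n : nat) (u w : 'cV[C]_n) : C :=
  (u^T *m map_mx Num.conj w) 0 0.

Definition sqnorm (C : numClosedFieldType) (n : nat) (u : 'cV[C]_n) : C :=
  inner u u.

Definition mx_image (C : numClosedFieldType) (n : nat) (M : 'M[C]_n)
    (W : {vspace 'cV[C]_n}) : {vspace 'cV[C]_n} :=
  (linfun (mulmx M) @: W)%VS.

Definition is_module (C : numClosedFieldType) (n : nat)
    (B : 'M[C]_n -> Prop) (W : {vspace 'cV[C]_n}) : Prop :=
  forall (M : 'M[C]_n) (w : 'cV[C]_n), B M -> w \in W -> M *m w \in W.

Definition is_irreducible (C : numClosedFieldType) (n : nat)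
    (B : 'M[C]_n -> Prop) (W : {vspace 'cV[C]_n}) : Prop :=
  [/\ is_module B W, W <> 0%VS &
      forall U : {vspace 'cV[C]_n}, (U <= W)%VS -> is_module B U ->
        U = 0%VS \/ U = W].

Definition thin (C : numClosedFieldType) (X : finType) (e : rel X) (x : X)
    (W : {vspace 'cV[C]_#|X|}) : Prop :=
  forall i : nat, (i <= diameter e)%N ->
    (\dim (mx_image (dual_idem C e x i) W) <= 1)%N.

Definition has_endpoint (C : numClosedFieldType) (X : finType) (e : rel X)
    (x : X) (W : {vspace 'cV[C]_#|X|}) (r : nat) : Prop :=
  [/\ (r <= diameter e)%N, mx_image (dual_idem C e x r) W <> 0%VS &
      forall i : nat, (i < r)%N -> mx_image (dual_idem C e x i) W = 0%VS].

Definition local_eigenvalue (C : numClosedFieldType) (X : finType) (e : rel X)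
    (x : X) (W : {vspace 'cV[C]_#|X|}) (eta : C) : Prop :=
  exists w : 'cV[C]_#|X|,
    [/\ w \in mx_image (dual_idem C e x 2) W, w != 0 &
        dual_idem C e x 2 *m distance_mx C e 2 *m dual_idem C e x 2 *m w
          = eta *: w].

(* -1 - b_2 b_3 (t^2 - b_2)^{-1}; used at t = theta_1 and t = theta_d. *)
Definition tilde (C : numClosedFieldType) (p : nat -> nat -> nat -> nat)
    (t : C) : C :=
  - 1 - (bnum p 2)%:R * (bnum p 3)%:R * (t ^+ 2 - (bnum p 2)%:R)^-1.

(* Main.v *)
(** The entries of an idempotent [E_i] depend only on the distance of the two
    vertices, say through [f]; [f 0 = m_i / |X|] because the trace of [E_i] is
    its rank, and [A E_i = theta_i E_i] becomes a three-term recurrence for [f]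
    (here [a_j = 0], as the graph is bipartite).  The vector [v] is supported
    on [Gamma_2(x)] and orthogonal to the all-ones vector, since [W] vanishes
    at [x], and thinness makes it an eigenvector of [E*_2 A_2 E*_2].  Vertices
    of [Gamma_2(x)] are at mutual distance 0, 2 or 4, so
    [E*_2 E_i v = (f 0 + eta f 2 - (1 + eta) f 4) v].  As [E_i] is an orthogonal
    projection, the norm of [E_i v] follows by solving the recurrence.  The
    orthogonality is that of eigenvectors of [A]. *)
Require Import Defs.
From HB Require Import structures.
From mathcomp Require Import all_boot all_order all_algebra.
From mathcomp Require Import complex.
From mathcomp Require Import reals.
From mathcomp Require Import zify ring.

Set Implicit Arguments.
Unset Strict Implicit.
Unset Printing Implicit Defensive.

Import Order.TTheory GRing.Theory Num.Theory.
Local Open Scope ring_scope.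

(** * Walks, distance and parity *)

(** A walk shorter than the first hit of [find] contradicts minimality; long walks are covered
    because [find] never exceeds [#|X|]. *)
Lemma dist_le_size (X : finType) (e : rel X) (y : X) (s : seq X) :
  path e y s -> (dist e y (last y s) <= size s)%N.
Proof.
move=> ps; rewrite leqNgt; apply/negP => lt_s.
have ltsX : (size s < #|X|)%N.
  by apply: leq_trans lt_s _; rewrite -[X in (_ <= X)%N](size_iota 0) find_size.
have := before_find 0%N lt_s; rewrite nth_iota // add0n => /existsP[].
by exists (in_tuple s); rewrite /= ps eqxx.
Qed.

(** Removing repeated vertices from a walk brings its length below [#|X|], so the search defining
    [dist] succeeds. *)
Lemma dist_walk (X : finType) (e : rel X) (y z : X) :
  connected e ->
  exists s : seq X, [/\ path e y s, last y s = z & size s = dist e y z].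
Proof.
move=> conn; have /connectP[s0 ps0 ->] := conn y z.
case/shortenP: ps0 => s ps us _.
have ltsX : (size s < #|X|)%N.
  by have := card_uniqP us => /= <-; exact: max_card.
set P := fun n => [exists t : n.-tuple X, path e y t && (last y t == last y s)].
have hasP : has P (iota 0 #|X|).
  apply/hasP; exists (size s); first by rewrite mem_iota.
  by apply/existsP; exists (in_tuple s); rewrite /= ps eqxx.
have := nth_find 0%N hasP; rewrite nth_iota; last first.
  by move: hasP; rewrite has_find size_iota.
rewrite add0n => /existsP[t /andP[pt /eqP lt]].
by exists t; split=> //; rewrite size_tuple.
Qed.

Lemma dist_eq0 (X : finType) (e : rel X) (y z : X) :
  connected e -> (dist e y z == 0%N) = (y == z).
Proof.
move=> conn; apply/idP/eqP => [/eqP d0|<-].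
  have [s [_ ls]] := dist_walk y z conn.
  by rewrite d0 => /size0nil s0; rewrite -ls s0.
by have := @dist_le_size X e y [::] isT; rewrite leqn0.
Qed.

Lemma dist_edge (X : finType) (e : rel X) (y w z : X) :
  connected e -> e y w -> (dist e y z <= (dist e w z).+1)%N.
Proof.
move=> conn eyw; have [s [ps <- <-]] := dist_walk w z conn.
by apply: (@dist_le_size X e y (w :: s)); rewrite /= eyw.
Qed.

Lemma dist_descend (X : finType) (e : rel X) (y z : X) (h : nat) :
  connected e -> dist e y z = h.+1 -> exists2 w, e y w & dist e w z = h.
Proof.
move=> conn dyz; have [[|w s] [/= ps ls]] := dist_walk y z conn.
  by rewrite dyz.
rewrite dyz => -[ss]; case/andP: ps => eyw ps; exists w => //.
apply/eqP; rewrite eqn_leq -{1}ss -ls dist_le_size //=.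
by have := dist_edge z conn eyw; rewrite dyz ls ltnS.
Qed.

Lemma dist_eq1 (X : finType) (e : rel X) (y z : X) :
  irreflexive e -> connected e -> (dist e y z == 1%N) = e y z.
Proof.
move=> irr conn; apply/eqP/idP => [/(dist_descend conn)[w eyw /eqP]|eyz].
  by rewrite dist_eq0 // => /eqP <-.
apply/eqP; rewrite eqn_leq (@dist_le_size X e y [:: z]) /= ?eyz //.
by rewrite lt0n dist_eq0 //; apply: contraTneq eyz => ->; rewrite irr.
Qed.

Lemma distC (X : finType) (e : rel X) (y z : X) :
  symmetric e -> connected e -> dist e y z = dist e z y.
Proof.
move=> sym conn.
suff le_d a b : (dist e a b <= dist e b a)%N by apply/eqP; rewrite eqn_leq !le_d.
have [s [ps <- <-]] := dist_walk b a conn.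
have {2}<- : last (last b s) (rev (belast b s)) = b.
  by case: s {ps} => //= c s; rewrite rev_cons last_rcons.
rewrite -(size_belast b s) -size_rev dist_le_size // rev_path.
by rewrite (eq_path (e' := e)).
Qed.

Lemma dist_parity (X : finType) (e : rel X) (S : {set X}) (y z : X) :
  connected e -> (forall a b : X, e a b -> (a \in S) != (b \in S)) ->
  odd (dist e y z) = (y \in S) (+) (z \in S).
Proof.
move=> conn hS; have [s [ps <- <-]] := dist_walk y z conn.
elim: s y ps => [|w s IH] y /=; first by rewrite addbb.
case/andP=> /hS eyw /IH ->.
by case: (y \in S) (w \in S) eyw => -[] //=; case: (last w s \in S).
Qed.

(** The two distances differ by at most one, and the bipartition forbids equality; this is
    [a_h = 0]. *)
Lemma dist_neighbor (X : finType) (e : rel X) (y w z : X) (h : nat) :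
  symmetric e -> connected e -> bipartite e -> dist e y z = h -> e y w ->
  dist e w z = h.+1 \/ h = (dist e w z).+1.
Proof.
move=> sym conn [S hS] dyz eyw; have ewy : e w y by rewrite sym.
have := dist_edge z conn eyw; have := dist_edge z conn ewy.
have := dist_parity y z conn hS; have := dist_parity w z conn hS.
have := hS _ _ eyw; rewrite dyz.
case: (y \in S) (w \in S) (z \in S) => -[] [] //= _; lia.
Qed.

Lemma dist_attained (X : finType) (e : rel X) (h : nat) :
  connected e -> (h <= diameter e)%N -> (0 < diameter e)%N ->
  exists y z : X, dist e y z = h.
Proof.
move=> conn hD D0; have [y [z dyz]] : exists y z, dist e y z = diameter e.
  have cX : (0 < #|X|)%N.
    case: (posnP #|X|) => // /card0_eq X0; move: D0.
    by rewrite /diameter big_pred0 // => y; have := X0 y; rewrite inE.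
  have [y Dy] := @bigop.eq_bigmax X (fun y => \max_(z : X) dist e y z) cX.
  have [z Dz] := @bigop.eq_bigmax X (fun z => dist e y z) cX.
  by exists y, z; rewrite -Dz -Dy.
(* Walk along a geodesic towards [z], by induction on the gap [n] between the current distance and
   [h]. *)
move: hD; rewrite -dyz => /subnK; move: (_ - _)%N => n.
elim: n y {dyz} => [|n IH] y; first by exists y, z.
by rewrite addSn => /esym/(dist_descend conn)[w _ /esym/IH].
Qed.

(** * Intersection numbers *)

(** On a geodesic of length [h + 1] from [z] to [y] with first step [w], the vertex [z] itself is
    counted by [b_h] for the pair [w], [y]. *)
Lemma bnum_neq0 (X : finType) (e : rel X) (p : nat -> nat -> nat -> nat)
    (h : nat) :
  distance_regular e p -> (h < diameter e)%N -> bnum p h != 0%N.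
Proof.
move=> [sym irr conn hp] hD.
have [z [y dzy]] := dist_attained conn hD (leq_ltn_trans (leq0n h) hD).
have [w ezw dwy] := dist_descend conn dzy.
rewrite /bnum -(hp _ _ _ _ _ dwy) cards_eq0; apply/set0Pn; exists z.
by rewrite inE dist_eq1 // sym ezw (distC y z) //= dzy eqxx.
Qed.

Lemma card_neighbors (X : finType) (e : rel X) (p : nat -> nat -> nat -> nat)
    (y : X) :
  distance_regular e p -> #|[set w | e y w]| = valency p.
Proof.
move=> [sym irr conn hp]; rewrite /valency -(hp _ _ _ y y); last first.
  by apply/eqP; rewrite dist_eq0.
by apply: eq_card => w; rewrite !inE andbb dist_eq1.
Qed.

(** This is [k = c_1 + a_1 + b_1] with [c_1 = 1] and [a_1 = 0]. *)
Lemma bnum1 (X : finType) (e : rel X) (p : nat -> nat -> nat -> nat) :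
  distance_regular e p -> bipartite e -> (0 < diameter e)%N ->
  valency p = (bnum p 1).+1.
Proof.
move=> hdr hbip D0; have [sym irr conn hp] := hdr.
have [y [z dyz]] := dist_attained conn D0 D0.
have eyz : e y z by rewrite -dist_eq1 ?dyz.
rewrite -(card_neighbors y hdr) (cardsD1 z) inE eyz add1n; congr _.+1.
rewrite /bnum -(hp _ _ _ _ _ dyz); apply: eq_card => w.
rewrite !inE dist_eq1 // andbC; case eyw: (e y w) => //=.
rewrite -(dist_eq0 w z conn) (distC z w) //.
by have [->|[<-]] := dist_neighbor sym conn hbip dyz eyw.
Qed.

(** * Traces of idempotents, orthogonality and projections *)

(** For the full-rank factorization [E = C R], idempotence reads [C R C R = C R]. Cancelling [C] and
    [R] gives [R C = 1] in size [\rank E], and [C R] has the same trace as [R C]. *)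
Lemma mxtrace_idempotent (F : fieldType) (n : nat) (E : 'M[F]_n) :
  E *m E = E -> \tr E = (\rank E)%:R.
Proof.
move=> EE; rewrite -{1}(mulmx_base E) mxtrace_mulC.
suff -> : row_base E *m col_base E = 1%:M by rewrite mxtrace1.
apply: (row_free_inj (row_base_free E)).
apply: (row_full_inj (col_base_full E)).
by rewrite mul1mx [LHS]mulmxA mulmxA -[LHS]mulmxA !mulmx_base.
Qed.

Lemma orthogonal_eigenvectors (C : numClosedFieldType) (n : nat)
    (A : 'M[C]_n) (u w : 'cV[C]_n) (s t : C) :
  A^T = A -> map_mx Num.conj A = A -> A *m u = s *: u -> A *m w = t *: w ->
  t \is Num.real -> s != t -> inner u w = 0.
Proof.
move=> symA realA Au Aw tR st.
(* The product of [u^T], [A] and the conjugate of [w], bracketed in two ways, is both [s] and [t]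
   times [inner u w]; conjugation fixes the real [t]. *)
have := congr1 (fun M : 'M_1 => M 0 0) (mulmxA u^T A (map_mx Num.conj w)).
rewrite -{2}symA -trmx_mul Au -{1}realA -map_mxM Aw map_mxZ /= (conj_Creal tR).
rewrite [(s *: u)^T]linearZ -scalemxAr -scalemxAl.
rewrite [in LHS]mxE [in RHS]mxE -/(inner u w) => /eqP.
rewrite eq_sym -subr_eq0 -mulrBl mulf_eq0 subr_eq0 (negPf st).
by move/eqP.
Qed.

Lemma sqnorm_projection (C : numClosedFieldType) (n : nat) (E : 'M[C]_n)
    (v : 'cV[C]_n) :
  E^T = E -> map_mx Num.conj E = E -> E *m E = E ->
  sqnorm (E *m v) = inner (E *m v) v.
Proof.
move=> symE realE EE.
by rewrite /sqnorm /inner map_mxM realE trmx_mul symE mulmxA -(mulmxA v^T) EE.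
Qed.

Lemma sum_enum_val (V : nmodType) (X : finType) (F : X -> V) :
  \sum_(a < #|X|) F (enum_val a) = \sum_(y : X) F y.
Proof. by rewrite -big_enum_val. Qed.

(** * The Bose-Mesner algebra *)

Lemma trmx_adj_mx (C : numClosedFieldType) (X : finType) (e : rel X) :
  symmetric e -> (adj_mx C e)^T = adj_mx C e.
Proof. by move=> sym; apply/matrixP => a b; rewrite !mxE sym. Qed.

Lemma conj_adj_mx (C : numClosedFieldType) (X : finType) (e : rel X) :
  map_mx Num.conj (adj_mx C e) = adj_mx C e.
Proof. by apply/matrixP => a b; rewrite !mxE conjC_nat. Qed.

Lemma bose_mesner_conj (C : numClosedFieldType) (X : finType) (e : rel X) M :
  @bose_mesner C X e M -> bose_mesner e (map_mx Num.conj M).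
Proof.
elim=> {M} [M ->|a|M N _ IM _ IN|M N _ IM _ IN].
- by rewrite conj_adj_mx; apply: gen_alg_gen.
- by rewrite map_scalar_mx; apply: gen_alg_scalar.
- by rewrite map_mxD; apply: gen_alg_add.
- by rewrite map_mxM; apply: gen_alg_mul.
Qed.

(** A polynomial in [A] acts as a scalar on each eigenspace of [A]. The scalar [q] is chosen before
    [N], so that it serves both an idempotent and its conjugate. *)
Lemma bose_mesner_eigen (C : numClosedFieldType) (X : finType) (e : rel X)
    (M : 'M[C]_#|X|) (t : C) :
  bose_mesner e M ->
  exists q : C, forall N : 'M[C]_#|X|, adj_mx C e *m N = t *: N -> M *m N = q *: N.
Proof.
elim=> {M} [M ->|a|M N _ [q IM] _ [r IN]|M N _ [q IM] _ [r IN]].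
- by exists t.
- by exists a => N _; rewrite mul_scalar_mx.
- by exists (q + r) => K AK; rewrite mulmxDl IM // IN // scalerDl.
- exists (q * r) => K AK; rewrite -mulmxA IN // -scalemxAr IM //.
  by rewrite scalerA mulrC.
Qed.

Lemma bose_mesner_dist (C : numClosedFieldType) (X : finType) (e : rel X)
    (p : nat -> nat -> nat -> nat) (M : 'M[C]_#|X|) :
  distance_regular e p -> bose_mesner e M ->
  exists f : nat -> C,
    forall a b, M a b = f (dist e (enum_val a) (enum_val b)).
Proof.
move=> [sym irr conn hp].
elim=> {M} [M ->|a|M N _ [f IM] _ [g IN]|M N _ [f IM] _ [g IN]].
- by exists (fun i => (i == 1%N)%:R) => a b; rewrite mxE dist_eq1.
- exists (fun i => (i == 0%N)%:R * a) => b c.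
  by rewrite mxE dist_eq0 // (inj_eq enum_val_inj) mulr_natl.
- by exists (fun i => f i + g i) => a b; rewrite mxE IM IN.
(* [find] can return [#|X|] by default, so [#|X| + 1] bounds every value of [dist] without further
   argument. *)
pose n := #|X|.+1.
exists (fun h => \sum_(i < n) \sum_(j < n) f i * g j * (p h i j)%:R) => a b.
have ltn y z : (dist e y z < n)%N.
  by rewrite ltnS -[X in (_ <= X)%N](size_iota 0) find_size.
pose y := enum_val a; pose z := enum_val b.
rewrite mxE; under eq_bigr do rewrite IM IN (distC _ z) //.
rewrite (sum_enum_val (fun w => f (dist e y w) * g (dist e z w))).
(* Middle vertices are sorted by their distances [i] to [y] and [j] to [z]; each class has [p h i j]
   members, where [h = dist e y z]. *)
rewrite (partition_big (fun w => Ordinal (ltn y w)) xpredT) //=.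
apply: eq_bigr => i _.
rewrite (partition_big (fun w => Ordinal (ltn z w)) xpredT) //=.
apply: eq_bigr => j _.
rewrite -(hp _ _ _ y z (erefl _)) mulr_natr -sumr_const.
apply: eq_big => [w|w /andP[/eqP <- /eqP <-] //].
by rewrite inE -!val_eqE.
Qed.

Lemma trmx_bose_mesner (C : numClosedFieldType) (X : finType) (e : rel X)
    (p : nat -> nat -> nat -> nat) (M : 'M[C]_#|X|) :
  distance_regular e p -> bose_mesner e M -> M^T = M.
Proof.
move=> hdr bM; have [f fE] := bose_mesner_dist hdr bM.
have [sym _ conn _] := hdr.
by apply/matrixP => a b; rewrite mxE !fE distC.
Qed.

(* [E] acts as the identity on its whole eigenspace, so [E] and its conjugate
   fix each other. *)
Lemma conj_primitive_idempotent (C : numClosedFieldType) (X : finType)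
    (e : rel X) (p : nat -> nat -> nat -> nat) (t : C) (E : 'M[C]_#|X|) :
  distance_regular e p -> t \is Num.real -> primitive_idempotent_for e t E ->
  map_mx Num.conj E = E.
Proof.
move=> hdr tR [[[bE EE] E0 _] AE]; set F := map_mx _ E.
have AF : adj_mx C e *m F = t *: F.
  by rewrite -conj_adj_mx -map_mxM AE map_mxZ /= (conj_Creal tR).
have [q Eq] := bose_mesner_eigen t bE.
have q1 : q = 1.
  move: (Eq E AE); rewrite EE => /eqP; rewrite -subr_eq0 -{1}[E]scale1r.
  by rewrite -scalerBl scaler_eq0 (negPf E0) orbF subr_eq0 => /eqP.
have EF : E *m F = F by rewrite Eq // q1 scale1r.
have symE := trmx_bose_mesner hdr bE.
have symF : F^T = F := trmx_bose_mesner hdr (bose_mesner_conj bE).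
(* Transposing [E F = F] gives [F E = F], while conjugating it gives [F E = E]. *)
have := congr1 trmx EF; rewrite trmx_mul symE symF => FE.
rewrite -FE; have := congr1 (map_mx Num.conj) EF; rewrite map_mxM.
suff -> : map_mx Num.conj F = E by [].
by apply/matrixP => a b; rewrite !mxE conjCK.
Qed.

(** * The three-term recurrence *)

Lemma sum_natr_card (R : pzSemiRingType) (T : finType) (P : pred T) :
  \sum_(w : T) (P w)%:R = #|[set w | P w]|%:R :> R.
Proof.
rewrite -natr_sum -sum1_card [in RHS]big_mkcond; congr _%:R.
by apply: eq_bigr => w _; rewrite inE; case: (P w).
Qed.

(* As [bnum p 0 = valency p], the junk value [f 0.-1 = f 0] cancels at [h = 0]. *)
Lemma eigen_recurrence (C : numClosedFieldType) (X : finType) (e : rel X)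
    (p : nat -> nat -> nat -> nat) (M : 'M[C]_#|X|) (f : nat -> C) (t : C)
    (h : nat) :
  distance_regular e p -> bipartite e -> (h <= diameter e)%N ->
  (0 < diameter e)%N -> adj_mx C e *m M = t *: M ->
  (forall a b, M a b = f (dist e (enum_val a) (enum_val b))) ->
  (valency p)%:R * f h.-1 + (bnum p h)%:R * (f h.+1 - f h.-1) = t * f h.
Proof.
move=> hdr hbip hD D0 AM fM; have [sym irr conn hp] := hdr.
have [y [z dyz]] := dist_attained conn hD D0.
have := congr1 (fun N : 'M_#|X| => N (enum_rank y) (enum_rank z)) AM.
rewrite /= !mxE fM !enum_rankK dyz => <-.
under eq_bigr do rewrite mxE fM !enum_rankK.
rewrite (sum_enum_val (fun w => (e y w)%:R * f (dist e w z))).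
(* Both coefficients become sums of indicators over [w], compared term by term: a neighbor of [y]
   contributes [f h.+1] if it is farther from [z], and [f h.-1] otherwise. *)
rewrite -(card_neighbors y hdr) -sum_natr_card mulr_suml.
rewrite /bnum -(hp _ _ _ _ _ dyz) -sum_natr_card mulr_suml -big_split /=.
apply: eq_bigr => w _; rewrite dist_eq1 // (distC z w) //.
case eyw: (e y w); last by rewrite !mul0r addr0.
have [->|->] := dist_neighbor sym conn hbip dyz eyw.
  by rewrite eqxx !mul1r addrC subrK.
by rewrite /= [_ == _]ltn_eqF ?mul0r ?addr0.
Qed.

(** * Vectors of the module on the second subconstituent *)

Lemma mem_mx_imageP (C : numClosedFieldType) (n : nat) (M : 'M[C]_n)
    (W : {vspace 'cV[C]_n}) (u : 'cV[C]_n) :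
  reflect (exists2 w, w \in W & u = M *m w) (u \in mx_image M W).
Proof.
by apply: (iffP memv_imgP) => -[w Ww ->]; exists w => //; rewrite lfunE.
Qed.

Lemma dual_idemE (C : numClosedFieldType) (X : finType) (e : rel X) (x : X)
    (i : nat) (w : 'cV[C]_#|X|) (a : 'I_#|X|) :
  (dual_idem C e x i *m w) a 0 = (dist e x (enum_val a) == i)%:R * w a 0.
Proof. by rewrite mul_diag_mx !mxE. Qed.

Lemma dimv1_line (K : fieldType) (vT : vectType K) (U : {vspace vT})
    (u w : vT) :
  (\dim U <= 1)%N -> w != 0 -> w \in U -> u \in U -> exists c : K, u = c *: w.
Proof.
move=> dU w0 Uw Uu; apply/vlineP.
suff /eqP -> : (<[w]> == U)%VS by [].
by rewrite eqEdim -memvE Uw dim_vline w0.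
Qed.

(** The entry of [A^2 v] at [x] is [c_2] times the sum of the entries of [v]. It vanishes because
    [A^2 v] stays in [W], and [c_2] is nonzero. *)
Lemma sum_endpoint2 (C : numClosedFieldType) (X : finType) (e : rel X)
    (p : nat -> nat -> nat -> nat) (x : X) (W : {vspace 'cV[C]_#|X|})
    (v : 'cV[C]_#|X|) :
  distance_regular e p -> (2 <= diameter e)%N ->
  is_module (@terwilliger C X e x) W ->
  mx_image (dual_idem C e x 0) W = 0%VS -> v \in W ->
  (forall a, dist e x (enum_val a) != 2%N -> v a 0 = 0) ->
  \sum_a v a 0 = 0.
Proof.
move=> hdr hD mW W0 Wv supp; have [sym irr conn hp] := hdr.
pose A := adj_mx C e.
have TA : @terwilliger C X e x A by apply: gen_alg_gen; left.
have WAAv : A *m (A *m v) \in W by exact: mW TA (mW _ _ TA Wv).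
have : dual_idem C e x 0 *m (A *m (A *m v)) \in mx_image (dual_idem C e x 0) W.
  by apply/mem_mx_imageP; exists (A *m (A *m v)).
rewrite W0 memv0 => /eqP/matrixP/(_ (enum_rank x) 0).
rewrite dual_idemE enum_rankK dist_eq0 // eqxx.
rewrite mul1r mulmxA mxE [RHS]mxE => s0.
have c2 : (p 2 1 1)%N%:R != 0 :> C.
  have [y [z dyz]] := dist_attained conn hD (ltnW hD).
  have [w eyw /eqP] := dist_descend conn dyz; rewrite dist_eq1 // => ewz.
  rewrite pnatr_eq0 -(hp _ _ _ _ _ dyz) cards_eq0; apply/set0Pn; exists w.
  by rewrite inE !dist_eq1 // eyw sym.
apply: (mulfI c2); rewrite mulr0 -[RHS]s0 mulr_sumr; apply: eq_bigr => a _.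
have [d2|/supp ->] := eqVneq (dist e x (enum_val a)) 2%N; last by rewrite !mulr0.
congr (_ * _); rewrite mxE.
under eq_bigr do rewrite !mxE enum_rankK.
rewrite (sum_enum_val (fun w => (e x w)%:R * (e w (enum_val a))%:R)).
rewrite -(hp _ _ _ _ _ d2) -sum_natr_card; apply: eq_bigr => w _.
by rewrite !dist_eq1 // -natrM mulnb (sym w).
Qed.

(** * The local action of an idempotent *)

(** The left side is [(f0 - f2) - (1 + eta) * (f4 - f2)]. The recurrence gives
    [f0 - f2 = f0 * (k^2 - t^2) / (k * b1)], and [k = b1 + 1] makes [f4 - f2] factor as
    [- (f0 - f2) * (t^2 - b2) / (b2 * b3)]. *)
Lemma cosine_identity (F : fieldType) (k b1 b2 b3 t eta f0 f1 f2 f3 f4 : F) :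
  b1 != 0 -> b2 != 0 -> b3 != 0 -> k != 0 -> k = b1 + 1 ->
  k * f1 = t * f0 -> k * f0 + b1 * (f2 - f0) = t * f1 ->
  k * f1 + b2 * (f3 - f1) = t * f2 -> k * f2 + b3 * (f4 - f2) = t * f3 ->
  f0 + eta * f2 - (1 + eta) * f4 =
    f0 * ((k - t) * (k + t) / (k * b1))
       * (1 + (1 + eta) * (t ^+ 2 - b2) / (b2 * b3)).
Proof.
move=> b10 b20 b30 k0 kE e0 e1 e2 e3.
(* Each recurrence is solved for its highest term, from [f4] downwards, until only [f0] remains. *)
have -> : f4 = f2 + (t * f3 - k * f2) / b3 by rewrite -e3; field.
have -> : f3 = f1 + (t * f2 - k * f1) / b2 by rewrite -e2; field.
have -> : f2 = f0 + (t * f1 - k * f0) / b1 by rewrite -e1; field.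
have -> : f1 = t * f0 / k by rewrite -e0; field.
by move: k0; rewrite kE => k0; field; rewrite b10 b20 b30 k0.
Qed.

(* On [Gamma_2(x)] only the distances 0, 2 and 4 occur, and [A_4] is there
   [J - 1 - A_2], where [J] kills [v]. *)
Lemma local_action (C : numClosedFieldType) (X : finType) (e : rel X)
    (x : X) (eta : C) (v : 'cV[C]_#|X|) (M : 'M[C]_#|X|) (f : nat -> C) :
  symmetric e -> connected e -> bipartite e ->
  (forall a, dist e x (enum_val a) != 2%N -> v a 0 = 0) ->
  \sum_a v a 0 = 0 ->
  dual_idem C e x 2 *m distance_mx C e 2 *m dual_idem C e x 2 *m v = eta *: v ->
  (forall a b, M a b = f (dist e (enum_val a) (enum_val b))) ->
  inner (M *m v) v
    = (f 0%N + eta * f 2%N - (1 + eta) * f 4%N) * sqnorm v.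
Proof.
move=> sym conn [S hS] supp sum0 ev fM.
have E2v : dual_idem C e x 2 *m v = v.
  apply/matrixP => a j; rewrite ord1 dual_idemE.
  by have [_|/supp ->] := eqVneq; rewrite ?mul1r ?mulr0.
rewrite /sqnorm /inner !mxE mulr_sumr; apply: eq_bigr => a _; rewrite !mxE mulrA.
have [d2|/supp ->] := eqVneq (dist e x (enum_val a)) 2%N; last first.
  by rewrite !rmorph0 !mulr0.
congr (_ * _).
have A2v : \sum_b (dist e (enum_val a) (enum_val b) == 2%N)%:R * v b 0
    = eta * v a 0.
  have := congr1 (fun u : 'cV_#|X| => u a 0) ev.
  rewrite -mulmxA E2v -mulmxA dual_idemE d2 mul1r !mxE => <-.
  by apply: eq_bigr => b _; rewrite !mxE.
have A0v : \sum_b (dist e (enum_val a) (enum_val b) == 0%N)%:R * v b 0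
    = v a 0.
  rewrite (bigD1 a) //= dist_eq0 // eqxx mul1r big1 ?addr0 // => b ba.
  by rewrite dist_eq0 // (inj_eq enum_val_inj) eq_sym (negPf ba) mul0r.
(* The bracket after [f 4] is the indicator of distances other than 0 and 2, written so that its sum
   over [b] involves the vanishing sum of [v]. *)
have cosines b : M a b * v b 0 =
    f 0%N * ((dist e (enum_val a) (enum_val b) == 0%N)%:R * v b 0) +
    f 2%N * ((dist e (enum_val a) (enum_val b) == 2%N)%:R * v b 0) +
    f 4%N * (v b 0 - (dist e (enum_val a) (enum_val b) == 0%N)%:R * v b 0
                   - (dist e (enum_val a) (enum_val b) == 2%N)%:R * v b 0).
  have [xb2|/supp ->] := eqVneq (dist e x (enum_val b)) 2%N; last first.
    by rewrite !mulr0 !subrr mulr0 !addr0.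
  rewrite fM.
  (* Going through [x] bounds the distance by 4, and parity excludes 1 and 3. *)
  have [s [ps ls ss]] := dist_walk (enum_val a) x conn.
  have [r [pr lr sr]] := dist_walk x (enum_val b) conn.
  have := @dist_le_size _ e (enum_val a) (s ++ r).
  rewrite cat_path last_cat ls ps pr lr size_cat ss sr (distC _ x) // d2 xb2.
  move=> /(_ isT).
  have := dist_parity (enum_val a) (enum_val b) conn hS.
  have := dist_parity x (enum_val b) conn hS.
  have := dist_parity x (enum_val a) conn hS.
  rewrite d2 xb2.
  case: (x \in S); case: (_ \in S) => //; case: (_ \in S) => // _ _;
    case: (dist e (enum_val a) (enum_val b)) => [|[|[|[|[|n]]]]] //= _ _; ring.
rewrite (eq_bigr _ (fun b _ => cosines b)) !big_split /= -!mulr_sumr !sumrB.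
by rewrite A0v A2v sum0; ring.
Qed.

(** * The norm formula and the conclusion *)

Lemma ordered_eigenvalues_real (C : numClosedFieldType) (X : finType)
    (e : rel X) (p : nat -> nat -> nat -> nat) (theta : nat -> C) (i : nat) :
  ordered_eigenvalues e p theta -> (i <= diameter e)%N ->
  theta i \is Num.real.
Proof.
move=> [theta0 lt_theta _] iD.
have real0 : theta 0%N \is Num.real by rewrite theta0 realn.
case: i iD => // i iD; have /ltW/ler_real -> // := lt_theta 0%N i.+1 iD.
Qed.

Lemma thin_endpoint2_vector (C : numClosedFieldType) (X : finType)
    (e : rel X) (p : nat -> nat -> nat -> nat) (x : X)
    (W : {vspace 'cV[C]_#|X|}) (eta : C) (v : 'cV[C]_#|X|) :
  distance_regular e p -> (2 <= diameter e)%N ->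
  is_module (@terwilliger C X e x) W -> thin e x W -> has_endpoint e x W 2 ->
  local_eigenvalue e x W eta -> v \in mx_image (dual_idem C e x 2) W ->
  [/\ forall a, dist e x (enum_val a) != 2%N -> v a 0 = 0,
      \sum_a v a 0 = 0 &
      dual_idem C e x 2 *m distance_mx C e 2 *m dual_idem C e x 2 *m v
        = eta *: v].
Proof.
move=> hdr hD mW thinW [_ _ /(_ 0%N isT) W0] [w [Ww w0 ev]] Uv.
have supp a : dist e x (enum_val a) != 2%N -> v a 0 = 0.
  have /mem_mx_imageP[u _ ->] := Uv.
  by rewrite dual_idemE => /negPf ->; rewrite mul0r.
split=> //.
  apply: (sum_endpoint2 hdr hD mW W0 _ supp).
  have /mem_mx_imageP[u Wu ->] := Uv; apply: mW Wu.
  by apply: gen_alg_gen; right; exists 2%N.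
(* By thinness [v] is a multiple of the vector [w] that witnesses the local eigenvalue. *)
have [c ->] := dimv1_line (thinW 2%N hD) w0 Ww Uv.
by rewrite -scalemxAr ev scalerA mulrC -scalerA.
Qed.

(** This form has no [1 + eta] in a denominator, so it covers both cases of the theorem at once. *)
Lemma sqnorm_primitive_idempotent (C : numClosedFieldType) (X : finType)
    (e : rel X) (p : nat -> nat -> nat -> nat) (x : X) (eta t : C)
    (v : 'cV[C]_#|X|) (E : 'M[C]_#|X|) :
  distance_regular e p -> bipartite e -> (4 <= diameter e)%N ->
  t \is Num.real -> primitive_idempotent_for e t E ->
  (forall a, dist e x (enum_val a) != 2%N -> v a 0 = 0) ->
  \sum_a v a 0 = 0 ->
  dual_idem C e x 2 *m distance_mx C e 2 *m dual_idem C e x 2 *m v = eta *: v ->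
  let k : C := (valency p)%:R in
  let b (i : nat) : C := (bnum p i)%:R in
  sqnorm (E *m v) =
    (\rank E)%:R / #|X|%:R * ((k - t) * (k + t) / (k * b 1%N))
      * (1 + (1 + eta) * (t ^+ 2 - b 2%N) / (b 2%N * b 3%N)) * sqnorm v.
Proof.
move=> hdr hbip hD tR hE supp sum0 ev k b.
have [[[bE EE] _ _] AE] := hE; have [sym _ conn _] := hdr.
have [f fE] := bose_mesner_dist hdr bE.
have X0 : #|X|%:R != 0 :> C.
  by rewrite pnatr_eq0 -lt0n; apply/card_gt0P; exists x.
have f0E : f 0%N = (\rank E)%:R / #|X|%:R.
  apply: (mulIf X0); rewrite mulfVK // -mxtrace_idempotent // /mxtrace.
  rewrite (eq_bigr (fun=> f 0%N)) ?sumr_const ?card_ord ?mulr_natr // => a _.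
  by rewrite fE; congr f; apply/eqP; rewrite dist_eq0.
rewrite sqnorm_projection ?(trmx_bose_mesner hdr bE) //; last first.
  exact: conj_primitive_idempotent hdr tR hE.
rewrite (local_action sym conn hbip supp sum0 ev fE) -f0E.
have D0 : (0 < diameter e)%N by apply: leq_trans hD.
have rec h : (h <= 4)%N -> _ :=
  fun h4 => eigen_recurrence hdr hbip (leq_trans h4 hD) D0 AE fE.
have b0 h : (h <= 3)%N -> b h != 0.
  by move=> h3; rewrite pnatr_eq0 (bnum_neq0 hdr) // (leq_trans _ hD).
congr (_ * _).
apply: (@cosine_identity _ _ _ _ _ _ _ _ (f 1%N) _ (f 3%N)); do ?exact: b0.
- by rewrite /k (bnum1 hdr) // -natr1.
- by rewrite -(rec 0%N) //= mulrBr addrC subrK.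
- exact: (rec 1%N).
- exact: (rec 2%N).
- exact: (rec 3%N).
Qed.

Theorem theorem16p2 (R : realType) (X : finType) (e : rel X)
    (p : nat -> nat -> nat -> nat)
    (theta : nat -> R[i]) (E : nat -> 'M[R[i]]_#|X|)
    (x : X) (W : {vspace 'cV[R[i]]_#|X|}) (eta : R[i]) (v : 'cV[R[i]]_#|X|)
    (hdr : distance_regular e p) (hbip : bipartite e)
    (hD : (4 <= diameter e)%N) (hk : (3 <= valency p)%N)
    (htheta : ordered_eigenvalues e p theta)
    (hE : forall i : nat, (i <= diameter e)%N ->
            primitive_idempotent_for e (theta i) (E i))
    (hW : is_irreducible (@terwilliger R[i] X e x) W)
    (hthin : thin e x W)
    (hend : has_endpoint e x W 2)
    (heta : local_eigenvalue e x W eta)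
    (heta1 : tilde p (theta 1%N) < eta)
    (hetad : eta < tilde p (theta (diameter e)./2))
    (hv : v \in mx_image (dual_idem R[i] e x 2) W) (hv0 : v != 0) :
  let D := diameter e in
  let k : R[i] := (valency p)%:R in
  let b (i : nat) : R[i] := (bnum p i)%:R in
  let m (i : nat) : R[i] := (\rank (E i))%:R in
  let cardX : R[i] := #|X|%:R in
  [/\ forall i j : nat, (1 <= i <= D.-1)%N -> (1 <= j <= D.-1)%N -> i <> j ->
        inner (E i *m v) (E j *m v) = 0,
      eta <> - 1 ->
        let psi := b 2%N * (1 - b 3%N / (1 + eta)) in
        forall i : nat, (1 <= i <= D.-1)%N ->
          sqnorm (E i *m v) =
            (m i * (theta i - k) * (theta i + k) * (theta i ^+ 2 - psi))
              / (cardX * k * b 1%N * (psi - b 2%N)) * sqnorm v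
    & eta = - 1 ->
        forall i : nat, (1 <= i <= D.-1)%N ->
          sqnorm (E i *m v) =
            (m i * (k - theta i) * (k + theta i)) / (cardX * k * b 1%N)
              * sqnorm v].
Proof.
move=> D k b m cardX.
have [irrM _ _] := hW; have [sym irr conn _] := hdr.
have [supp sum0 ev] :=
  thin_endpoint2_vector hdr (ltnW (ltnW hD)) irrM hthin hend heta hv.
have leD i : (1 <= i <= D.-1)%N -> (i <= diameter e)%N.
  by case/andP=> _ iD; apply: leq_trans iD (leq_pred _).
have realt i : (1 <= i <= D.-1)%N -> theta i \is Num.real.
  by move/leD; apply: ordered_eigenvalues_real htheta.
have norm i (hi : (1 <= i <= D.-1)%N) :=
  sqnorm_primitive_idempotent hdr hbip hD (realt i hi) (hE _ (leD i hi))
    supp sum0 ev.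
have b0 h : (h <= 3)%N -> b h != 0.
  by move=> h3; rewrite pnatr_eq0 (bnum_neq0 hdr) // (leq_trans _ hD).
(* [bnum p 0] and [valency p] both unfold to [p 0 1 1]. *)
have k0 : k != 0 := b0 0%N isT.
have X0 : cardX != 0 by rewrite pnatr_eq0 -lt0n; apply/card_gt0P; exists x.
have [b1 b2 b3] : [/\ b 1%N != 0, b 2%N != 0 & b 3%N != 0] by split; apply: b0.
split=> [i j hi hj ij|eta1 psi i hi|eta1 i hi].
- have AE l (hl : (1 <= l <= D.-1)%N) :
      adj_mx _ e *m (E l *m v) = theta l *: (E l *m v).
    by have [_ AE] := hE l (leD l hl); rewrite mulmxA AE scalemxAl.
  apply: (orthogonal_eigenvectors _ _ (AE i hi) (AE j hj) (realt j hj)).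
  + exact: trmx_adj_mx.
  + exact: conj_adj_mx.
  + have [_ lt_theta _] := htheta.
    move/eqP: ij; rewrite neq_ltn => /orP[ij|ij].
      by rewrite gt_eqF // lt_theta // ij leD.
    by rewrite lt_eqF // lt_theta // ij leD.
- have eta10 : 1 + eta != 0.
    by rewrite addrC addr_eq0; apply/eqP.
  (* Hence [1 + (1 + eta) * (t^2 - b_2) / (b_2 * b_3)] equals [- (t^2 - psi) / (psi - b_2)]; the
     sign is absorbed by [(k - t) * (k + t) = - (t - k) * (t + k)]. *)
  have psiE : psi - b 2%N = - (b 2%N * b 3%N) / (1 + eta) by rewrite /psi; field.
  rewrite norm //; congr (_ * _); rewrite psiE /psi.
  rewrite -/(b 1%N) -/(b 2%N) -/(b 3%N) -/k -/(m i) -/cardX.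
  by field; rewrite eta10 X0 k0 b1 b2 b3.
(* At [eta = -1] the factor containing [1 + eta] reduces to 1. *)
- rewrite norm // eta1 subrr !mul0r addr0 mulr1; congr (_ * _).
  by rewrite -/(b 1%N) -/k -/(m i) -/cardX; field; rewrite X0 k0 b1.
Qed.
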